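(* The supremum of $\chi_{fb}(G,\sigma)$ over all planar signed simple graphs $(G,\sigma)$ is at least $2+\frac{1}{41}=\frac{83}{41}$.
   Context: A signed graph $(G,\sigma)$ is a graph $G$ together with a signature $\sigma: E(G)\to\{+,-\}$. A cycle is negative if it has an odd number of negative edges. A set of vertices is balanced if the subgraph it induces contains no negative cycle. For positive integers $p,q$, a balanced $(p,q)$-coloring of $(G,\sigma)$ is an assignment to each vertex of a set of $q$ colors from $\{1,\dots,p\}$ such that, for each color, the set of vertices receiving that color is balanced. The fractional balanced chromatic number $\chi_{fb}(G,\sigma)$ is the minimum of $p/q$ over all pairs $(p,q)$ for which a balanced $(p,q)$-coloring exists. A simple graph has no loops and no parallel edges. *)

(* Defs.v *)
From HB Require Import structures.
From mathcomp Require Import all_boot all_order all_algebra.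
From mathcomp Require Import all_classical all_reals all_analysis.

Set Implicit Arguments.
Unset Strict Implicit.
Unset Printing Implicit Defensive.

Import Order.TTheory GRing.Theory Num.Theory.
Import numFieldNormedType.Exports.

Local Open Scope classical_set_scope.
Local Open Scope ring_scope.

Record sgraph := SGraph {
  vertex :> finType;
  adj : rel vertex;
  adj_sym : symmetric adj;
  adj_irrefl : irreflexive adj }.

Definition edges (G : sgraph) : {set {set G}} :=
  [set [set xy.1; xy.2]%SET | xy in [pred xy : G * G | adj xy.1 xy.2]]%SET.

(* [negative e] is [true] iff the edge [e] has sign [-]; its values outside *)
(* [edges] are never used.                                                  *)
Record signed_sgraph := SignedSGraph {
  graph :> sgraph;
  negative : {set graph} -> bool }.

Section Balanced.
Variable G : signed_sgraph.

Definition is_cycle (e : rel G) (c : seq G) : Prop :=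
  (2 < size c)%N /\ ucycle e c.

Definition negative_cycle (c : seq G) : bool :=
  odd (count (fun x => negative [set x; next c x]%SET) c).

Definition balanced (S : {set G}) : Prop :=
  ~ exists c : seq G, is_cycle [rel x y in S | adj x y] c /\ negative_cycle c.

Definition balanced_coloring (p q : nat) (f : G -> {set 'I_p}) : Prop :=
  (forall v, #|f v| = q) /\
  (forall i : 'I_p, balanced [set v | i \in f v]%SET).

Definition balanced_colorable (p q : nat) : Prop :=
  exists f : G -> {set 'I_p}, balanced_coloring q f.

End Balanced.

Section FractionalBalanced.
Variable R : realType.

Definition balanced_ratios (G : signed_sgraph) : set R :=
  [set x | exists p q : nat,
     [/\ (0 < p)%N, (0 < q)%N, balanced_colorable G p q & x = p%:R / q%:R]].

Definition chi_fb (G : signed_sgraph) : R := inf (balanced_ratios G).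

Lemma chi_fb_min (G : signed_sgraph) (x : R) :
  balanced_ratios G x -> lbound (balanced_ratios G) x -> chi_fb G = x.
Proof.
move=> Gx lbx; apply/eqP; rewrite eq_le; apply/andP; split.
- by apply: ge_inf => //; exists x.
- by apply: lb_le_inf => //; exists x.
Qed.

(* A drawing in the plane [R * R]: each edge [e] is drawn as the arc          *)
(* [arc e @` `[0, 1]], joining its two ends; the interior of an arc contains  *)
(* no vertex and no point of any other arc.                                   *)
Definition plane_drawing (G : sgraph) (pos : G -> R * R)
    (arc : {set G} -> R -> R * R) : Prop :=
  [/\ injective pos,
      forall e, e \in edges G ->
        [/\ {within `[0, 1], continuous (arc e)},
            {in `[0, 1] &, injective (arc e)} &
            [set arc e 0; arc e 1] = pos @` [set x | x \in e]],
      forall e, e \in edges G ->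
        forall t v, t \in `]0, 1[ -> arc e t <> pos v &
      forall e e', e \in edges G -> e' \in edges G -> e != e' ->
        forall s t, s \in `]0, 1[ -> t \in `[0, 1] -> arc e s <> arc e' t].

Definition planar (G : sgraph) : Prop :=
  exists pos arc, @plane_drawing G pos arc.

End FractionalBalanced.

(* Main.v *)
(** If the vertices of [G] carry weights of total [w] and every balanced set has
    weight at most [M], then [w / M <= chi_fb G].  We exhibit a planar signed
    triangulation on 58 vertices with such weights of total 81 and [M = 40], so
    that its fractional balanced chromatic number is at least
    [81 / 40 > 83 / 41].

    The triangulation is glued from small pieces along triangles.  For a
    balanced set [S]:
    - a tetrahedron with four negative faces contains at most two vertices of
      [S], and at most one if [S] misses its base triangle;
    - a positive triangle can be filled with four vertices, of which [S]
      contains at most two, and at most one if [S] contains the triangle;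
    - a signed triangulation of Tutte-fragment type, with such pieces in seven
      of its faces, has two distinguished outer vertices [a] and [b]; if [S]
      contains both, it misses the base of one of five tetrahedra or contains
      the triangle of one of two filled positive triangles;
    - two copies of the latter, two tetrahedra and two filled positive triangles
      are attached to a core of eight vertices on which no balanced set can be
      too heavy without [S] losing weight in one of the attached pieces.
    Each of these facts is a finite check that uses a few explicit negative
    cycles, and adding them up gives the bound 40. *)

Require Import Defs.
From Stdlib Require Import ZArith.
From HB Require Import structures.
From mathcomp Require Import all_boot all_order all_algebra.
From mathcomp Require Import all_classical all_reals all_analysis.
From mathcomp Require Import ssrZ zify ring lra.

Set Implicit Arguments.
Unset Strict Implicit.
Unset Printing Implicit Defensive.

Import Order.TTheory GRing.Theory Num.Theory.
Import numFieldNormedType.Exports.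

Local Open Scope classical_set_scope.
Local Open Scope ring_scope.

(** * Straight-line drawings via orientations of point triples *)

(** Twice the signed area of the triangle [a b c], over any ring so that it can be computed in [Z]
    and transferred to the reals. *)
Definition orient (T : pzRingType) (a b c : T * T) : T :=
  (b.1 - a.1) * (c.2 - a.2) - (b.2 - a.2) * (c.1 - a.1).

Section StraightLine.
Variable R : realType.
Implicit Types (a b c d : R * R) (s t : R).

Definition segment a b (t : R) : R * R :=
  ((1 - t) * a.1 + t * b.1, (1 - t) * a.2 + t * b.2).

Lemma segment0 a b : segment a b 0 = a.
Proof. by case: a => x y; rewrite /segment /= !mul0r subr0 !mul1r !addr0. Qed.

Lemma segment1 a b : segment a b 1 = b.
Proof. by case: b => x y; rewrite /segment /= subrr !mul0r !mul1r !add0r. Qed.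

Lemma segmentC a b t : segment a b t = segment b a (1 - t).
Proof. by rewrite /segment; congr pair; ring. Qed.

Lemma segment_inj a b : a <> b -> injective (segment a b).
Proof.
case: a b => a1 a2 [b1 b2] ab s t [/eqP e1 /eqP e2]; apply: contrapT => /eqP st.
have {}st : s - t != 0 by rewrite subr_eq0.
case: ab; congr pair; apply/eqP; rewrite -subr_eq0 -(mulrI_eq0 _ (mulfI st)).
- by move: e1; rewrite -subr_eq0 => /eqP e1; apply/eqP; rewrite /=; lra.
- by move: e2; rewrite -subr_eq0 => /eqP e2; apply/eqP; rewrite /=; lra.
Qed.

Lemma segment_continuous a b : continuous (segment a b).
Proof.
have lin (x y t : R) : (1 - u) * x + u * y @[u --> t] --> (1 - t) * x + t * y.
  apply: cvgD; apply: cvgM; [apply: cvgB| | |]; try exact: cvg_cst; exact: cvg_id.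
by move=> t; exact: cvg_pair (lin a.1 b.1 t) (lin a.2 b.2 t).
Qed.

Lemma orient_segment a b c d t :
  orient a b (segment c d t) = (1 - t) * orient a b c + t * orient a b d.
Proof. by rewrite /orient /segment /=; ring. Qed.

Lemma orient_l a b : orient a b a = 0.
Proof. by rewrite /orient; ring. Qed.

Lemma orient_r a b : orient a b b = 0.
Proof. by rewrite /orient; ring. Qed.

Lemma orient_on_line a b t : orient a b (segment a b t) = 0.
Proof. by rewrite orient_segment orient_l orient_r !mulr0 addr0. Qed.

Lemma convex_same_sign_neq0 (x y t : R) :
  0 < x * y -> t \in `[0, 1] -> (1 - t) * x + t * y != 0.
Proof.
rewrite in_itv /= => xy /andP[t0 t1]; apply/negP => /eqP h.
(* Multiplying by [x + y] produces squares plus [x * y > 0], with no case split on the common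
   sign. *)
have e : x * ((1 - t) * x + t * y) + y * ((1 - t) * x + t * y) = 0.
  by rewrite h !mulr0 addr0.
have : (1 - t) * x ^+ 2 + t * y ^+ 2 + x * y = 0.
  by rewrite -[RHS]e; ring.
by have := sqr_ge0 x; have := sqr_ge0 y; nra.
Qed.

(** The last hypothesis separates disjoint edges by the line through one of them; edges with a
    common end are handled by the second one. *)
Lemma straight_line_planar (G : sgraph) (pos : G -> R * R) :
    injective pos ->
    (forall x y v, adj x y -> v != x -> v != y -> orient (pos x) (pos y) (pos v) != 0) ->
    (forall x y u v, adj x y -> adj u v -> u != x -> u != y -> v != x -> v != y ->
       0 < orient (pos x) (pos y) (pos u) * orient (pos x) (pos y) (pos v) \/
       0 < orient (pos u) (pos v) (pos x) * orient (pos u) (pos v) (pos y)) ->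
  planar R G.
Proof.
move=> pos_inj line cross.
pose arc (e : {set G}) (t : R) : R * R :=
  if [pick xy : G * G | adj xy.1 xy.2 && (e == [set xy.1; xy.2]%SET)] is Some xy
  then segment (pos xy.1) (pos xy.2) t else (0, 0).
have arcP e : e \in edges G -> exists x y, [/\ adj x y, e = [set x; y]%SET &
    arc e = segment (pos x) (pos y)].
  move=> /imsetP[[x y]]; rewrite inE /= => xy ->; rewrite /arc.
  case: pickP => [[u v] /= /andP[uv /eqP euv]|/(_ (x, y))]; last by rewrite /= xy eqxx.
  by exists u, v.
have neq_pos x y : adj x y -> pos x <> pos y.
  by move=> xy /pos_inj exy; move: xy; rewrite exy adj_irrefl.
have off x y v t : adj x y -> t \in `]0, 1[ -> segment (pos x) (pos y) t <> pos v.
  move=> xy; rewrite in_itv /= => /andP[t0 t1] e.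
  have [vx|vx] := eqVneq v x.
    move: e; rewrite vx -[RHS](segment0 _ (pos y)) => /(segment_inj (neq_pos _ _ xy)) t00.
    by move: t0; rewrite t00 ltxx.
  have [vy|vy] := eqVneq v y.
    move: e; rewrite vy -[RHS](segment1 (pos x)) => /(segment_inj (neq_pos _ _ xy)) t11.
    by move: t1; rewrite t11 ltxx.
  by have := line _ _ _ xy vx vy; rewrite -e orient_on_line eqxx.
exists pos, arc; split => //.
- move=> e /arcP[x [y [xy -> ->]]]; split.
  + by apply: continuous_subspaceT; exact: segment_continuous.
  + by move=> s t _ _; apply: segment_inj; exact: neq_pos.
  + rewrite segment0 segment1; apply/seteqP; split => [p /= [->|->]|p /= [v]].
    * by exists x => //=; rewrite !inE eqxx.
    * by exists y => //=; rewrite !inE eqxx orbT.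
    * by rewrite !inE => /orP[] /eqP -> <-; [left|right].
- by move=> e /arcP[x [y [xy _ ->]]] t v; exact: off.
move=> e e' /arcP[x [y [xy ex ->]]] /arcP[u [v [uv eu ->]]]; rewrite ex eu => neq s t s01 t01 st.
(* Along [a c] the orientation relative to [x y] is [r] times a nonzero number, so a meeting point
   has [r = 0] and is the vertex [a], which lies inside no edge. *)
have shared (a c : G) (r : R) : a \in [set x; y]%SET -> c != x -> c != y ->
    segment (pos a) (pos c) r <> segment (pos x) (pos y) s.
  rewrite !inE => ax cx cy er.
  have := orient_on_line (pos x) (pos y) s; rewrite -er orient_segment.
  have -> : orient (pos x) (pos y) (pos a) = 0.
    by case/orP: ax => /eqP ->; rewrite ?orient_l ?orient_r.
  rewrite mulr0 add0r => /eqP; rewrite mulf_eq0 (negPf (line _ _ _ xy cx cy)) orbF => /eqP r0.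
  by move: er; rewrite r0 segment0 => /esym; exact: off.
have [uxy|] := boolP (u \in [set x; y]%SET).
  have [vxy|] := boolP (v \in [set x; y]%SET).
    have uNv : u != v by apply/eqP => uv'; move: uv; rewrite uv' adj_irrefl.
    case/negP: neq; rewrite eq_sym finset.eqEcard finset.subUset !finset.sub1set uxy vxy.
    rewrite !cards2 uNv /=.
    by case: (x != y).
  by rewrite !inE negb_or => /andP[vx vy]; exact: (shared u v t uxy vx vy (esym st)).
rewrite !inE negb_or => /andP[ux uy].
have [vxy|] := boolP (v \in [set x; y]%SET).
  by apply: (shared v u (1 - t)) => //; rewrite st [RHS]segmentC.
rewrite !inE negb_or => /andP[vx vy].
case: (cross _ _ _ _ xy uv ux uy vx vy) => h.
- have := convex_same_sign_neq0 h t01.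
  by rewrite -orient_segment -st orient_on_line eqxx.
- have : s \in `[0, 1] by apply: subset_itv_oo_cc.
  by move/(convex_same_sign_neq0 h); rewrite -orient_segment st orient_on_line eqxx.
Qed.

End StraightLine.

(** * Lower bounds on the fractional number from vertex weights *)

Section WeightBound.
Variable G : signed_sgraph.

Lemma balanced_sub1 (S : {set G}) : (#|S| <= 1)%N -> balanced S.
Proof.
move=> S1 [c [[c2 /andP[cS cu]] _]].
have sub : {subset c <= S}.
  move=> x xc; have := next_cycle cS xc; by move=> /= /andP[/andP[]].
have := leq_trans (uniq_leq_size cu (s2 := enum S) _) (_ : size (enum S) <= 1)%N.
rewrite -cardE S1 => /(_ _ isT) H.
have : (size c <= 1)%N by apply: H => x /sub; rewrite mem_enum.
by rewrite leqNgt (ltn_trans _ c2).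
Qed.

(** Makes the set of ratios nonempty, as a lower bound on its infimum requires. The extra color
    keeps [p] positive even for the empty graph. *)
Lemma balanced_colorable_card : balanced_colorable G #|G|.+1 1.
Proof.
exists (fun v => [set lift ord0 (enum_rank v)]%SET); split=> [v|i]; first exact: cards1.
apply: balanced_sub1; apply/card_le1_eqP => x y; rewrite !inE => /eqP -> /eqP.
by move/lift_inj/enum_rank_inj.
Qed.

(** Double counting of entries of [W] against their colors; repeated entries encode integer
    weights. *)
Lemma weight_bound (W : seq G) (M p q : nat) :
    (forall S : {set G}, balanced S -> count [in S] W <= M)%N ->
  balanced_colorable G p q -> (size W * q <= M * p)%N.
Proof.
move=> WM [f [fq fb]].
suff -> : (size W * q = \sum_(i < p) count [in [set v | i \in f v]%SET] W)%N.
  by rewrite mulnC -[X in (_ <= X * _)%N]card_ord -sum_nat_const; apply: leq_sum => i _; apply: WM.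
elim: W {WM} => [|v W IHW] /=; first by rewrite mul0n big1.
rewrite big_split /= -IHW mulSn -(fq v) -sum1_card big_mkcond /=.
by congr addn; apply: eq_bigr => i _; rewrite inE; case: (i \in f v).
Qed.

Lemma chi_fb_ge (R : realType) (W : seq G) (M : nat) : (0 < M)%N ->
    (forall S : {set G}, balanced S -> count [in S] W <= M)%N ->
  (size W)%:R / M%:R <= chi_fb R G.
Proof.
move=> M0 WM; apply: lb_le_inf.
  exists (#|G|.+1%:R / 1%:R), #|G|.+1, 1%N; split => //; exact: balanced_colorable_card.
move=> x [p [q [p0 q0 Gpq ->]]]; have le := weight_bound WM Gpq.
rewrite ler_pdivrMr ?ltr0n// mulrAC ler_pdivlMr ?ltr0n//.
by rewrite -!natrM ler_nat [(p * M)%N]mulnC.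
Qed.

End WeightBound.

(** * Signed graphs given by edge lists *)

Section ListGraph.
Variables (n : nat) (posE negE : seq (nat * nat)).

Definition in_edges (E : seq (nat * nat)) (i j : nat) := ((i, j) \in E) || ((j, i) \in E).

Definition list_adj : rel nat := in_edges (posE ++ negE).

Hypothesis loopless : all (fun e => e.1 != e.2) (posE ++ negE).

Definition ord_adj (x y : 'I_n) := list_adj x y.

Lemma ord_adj_sym : symmetric ord_adj.
Proof. by move=> x y; rewrite /ord_adj /list_adj /in_edges orbC. Qed.

Lemma ord_adj_irrefl : irreflexive ord_adj.
Proof.
move=> x; apply/negbTE; rewrite /ord_adj /list_adj /in_edges orbb; apply/negP.
by move/(allP loopless); rewrite eqxx.
Qed.

Definition list_sgraph : sgraph := SGraph ord_adj_sym ord_adj_irrefl.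

Definition list_negative (e : {set list_sgraph}) : bool :=
  [exists x : 'I_n, exists y : 'I_n, [&& x \in e, y \in e & ((x : nat), (y : nat)) \in negE]].

Definition list_signed : signed_sgraph := SignedSGraph list_negative.

Lemma list_negativeE (x y : 'I_n) :
  list_negative [set x; y]%SET = in_edges negE x y.
Proof.
apply/existsP/idP => [[u /existsP[v /and3P[]]]|]; last first.
  case/orP => h; [exists x; apply/existsP; exists y|exists y; apply/existsP; exists x];
  by rewrite !inE !eqxx ?orbT.
(* The vertices [u] and [v] might coincide; looplessness excludes it. *)
have irr (z : 'I_n) : ((z : nat), (z : nat)) \notin negE.
  by apply/negP => zz; have := allP loopless (z : nat, z : nat); rewrite mem_cat zz orbT eqxx => /(_ isT).
rewrite !inE => /orP[] /eqP -> /orP[] /eqP ->; rewrite /in_edges ?(negPf (irr _)) //.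
- by move=> ->.
- by move=> ->; rewrite orbT.
Qed.

Definition neg_cycle_list (l : seq nat) : bool :=
  [&& (2 < size l)%N, uniq l, all (fun k => k < n)%N l, cycle list_adj l
    & odd (count (fun k => in_edges negE k (next l k)) l)].

Lemma balanced_neg_cycle (S : {set list_signed}) (c : seq 'I_n) :
  balanced S -> neg_cycle_list (map val c) -> ~~ all [in S] c.
Proof.
move=> bS /and5P[c2 cu _ cc co]; apply/negP => cS; apply: bS; exists c.
move: c2 cu cc co; rewrite size_map (map_inj_uniq val_inj) cycle_map => c2 cu cc co.
split; first (split => //; apply/andP; split => //).
  by apply: sub_in_cycle cS cc => x y /= xS yS e; rewrite xS yS; exact: e.
move: co; rewrite /negative_cycle count_map; congr (is_true (odd _)).
by apply: eq_count => x /=; rewrite list_negativeE (next_map val_inj cu).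
Qed.

End ListGraph.

(** * Certifying a drawing by integer arithmetic *)

Lemma orient_swap (R : comPzRingType) (a b c : R * R) : orient b a c = - orient a b c.
Proof. by rewrite /orient; ring. Qed.

Section ListDrawing.
Variables (n : nat) (posE negE : seq (nat * nat)) (P : seq (Z * Z)).
Hypothesis loopless : all (fun e => e.1 != e.2) (posE ++ negE).

Definition orientZ (i j k : nat) : Z :=
  orient (nth (0, 0) P i) (nth (0, 0) P j) (nth (0, 0) P k).

Definition drawing_check : bool :=
  let E := posE ++ negE in
  [&& size P == n, uniq P,
      all (fun e => all (fun v => [|| v == e.1, v == e.2 | orientZ e.1 e.2 v != 0]) (iota 0 n)) E
    & all (fun e => all (fun f =>
        [|| f.1 == e.1, f.1 == e.2, f.2 == e.1, f.2 == e.2,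
            0 < orientZ e.1 e.2 f.1 * orientZ e.1 e.2 f.2
          | 0 < orientZ f.1 f.2 e.1 * orientZ f.1 f.2 e.2]) E) E].

Variable R : realType.

Let zr : {rmorphism Z -> R} := intr \o int_of_Z.

Let zr_eq0 (z : Z) : (zr z == 0) = (z == 0).
Proof. by rewrite /= intr_eq0 (can2_eq int_of_ZK Z_of_intK). Qed.

Let zr_inj : injective zr.
Proof. by move=> a b /eqP; rewrite -subr_eq0 -rmorphB zr_eq0 subr_eq0 => /eqP. Qed.

Let zr_gt0 (z : Z) : (0 < zr z) = (0 < z).
Proof. by rewrite /= ltr0z -[in RHS](int_of_ZK z) ssrZ.Instances.Z_of_intE ltr0z. Qed.

(** The embedding of [Z] into the reals preserves signs of orientations. Each edge is listed in one
    direction only; [swap] covers the other. *)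
Lemma list_planar : drawing_check -> planar R (list_sgraph n loopless).
Proof.
case/and4P => /eqP sP uP /allP line /allP cross.
pose pos (v : 'I_n) : R * R := (zr (nth (0, 0) P v).1, zr (nth (0, 0) P v).2).
have orient_pos (x y v : 'I_n) : orient (pos x) (pos y) (pos v) = zr (orientZ x y v).
  by rewrite /orientZ /orient /pos /= !(rmorphB, rmorphM) /=.
have lt_size (v : 'I_n) : (v < size P)%N by rewrite sP.
have swap i j k : orientZ j i k = - orientZ i j k by exact: orient_swap.
apply: (@straight_line_planar R (list_sgraph n loopless) pos).
- move=> x y [/zr_inj e1 /zr_inj e2]; apply/val_inj/eqP.
  rewrite -(nth_uniq (0, 0) (lt_size x) (lt_size y) uP); apply/eqP.
  by rewrite [LHS]surjective_pairing [RHS]surjective_pairing e1 e2.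
- move=> x y v xy vx vy; rewrite orient_pos zr_eq0.
  have vn : (v : nat) \in iota 0 n by rewrite mem_iota add0n ltn_ord.
  case/orP: xy => /line /allP /(_ _ vn) /=; rewrite !(inj_eq val_inj) (negPf vx) (negPf vy) //.
  by rewrite swap oppr_eq0.
- move=> x y u v xy uv ux uy vx vy; rewrite !orient_pos -!rmorphM !zr_gt0.
  apply/orP.
  case/orP: xy => /cross /allP xy; case/orP: uv => /xy /=;
    rewrite !(inj_eq val_inj) (negPf ux) (negPf uy) (negPf vx) (negPf vy) /=.
  + by [].
  + by rewrite [orientZ v u _]swap [orientZ v u _]swap mulrNN [_ * orientZ x y u]mulrC.
  + by rewrite ![orientZ y x _]swap mulrNN [orientZ u v y * _]mulrC.
  + by rewrite ![orientZ y x _]swap ![orientZ v u _]swap !mulrNN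
      [orientZ u v y * _]mulrC [_ * orientZ x y u]mulrC.
Qed.

End ListDrawing.

(** * Exhaustive checks over the traces of a balanced set on a piece *)

Fixpoint bitseqs (n : nat) : seq bitseq :=
  if n is n'.+1 then [seq b :: bs | b <- [:: false; true], bs <- bitseqs n'] else [:: [::]].

Lemma mem_bitseqs (bs : bitseq) : bs \in bitseqs (size bs).
Proof.
elim: bs => //= b bs IH; rewrite cats0 mem_cat.
by case: b; rewrite (mem_map (fun _ _ => _)) ?IH ?orbT // => ? ? [].
Qed.

Section LocalBound.
Variables (n : nat) (posE negE : seq (nat * nat)).
Hypothesis loopless : all (fun e => e.1 != e.2) (posE ++ negE).
Variable S : {set list_signed n.+1 loopless}.
Hypothesis bS : balanced S.

Let s (k : nat) : bool := inord k \in S.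

(* [m] embeds a template with vertices [0 .. size m - 1] in the graph, and [C]
   lists cycles of the template whose images are negative. *)
Lemma local_bound (m : seq nat) (C : seq (seq nat)) (Q : pred bitseq) :
    all (fun c => neg_cycle_list n.+1 posE negE (map (nth 0%N m) c)) C ->
    all (fun b => has (all (nth false b)) C || Q b) (bitseqs (size m)) ->
  Q (map s m).
Proof.
move=> /allP negC /allP /(_ (map s m)); rewrite -(size_map s) mem_bitseqs => /(_ isT).
case/orP => // /hasP[c cC cs].
have ncc := negC _ cC; have /and5P[_ _ /allP lt_n _ _] := ncc.
have valK : map val (map (@inord n) (map (nth 0%N m) c)) = map (nth 0%N m) c.
  by rewrite -[LHS]map_comp map_id_in // => k kc; rewrite /= inordK ?lt_n.
have /negP[] := balanced_neg_cycle bS (etrans (congr1 _ valK) ncc).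
rewrite !all_map; apply/allP => i /(allP cs) /=.
have [im|im] := ltnP i (size m); first by rewrite (nth_map 0%N).
(* An index outside [m] reads as [false], so it cannot occur in a fully selected cycle. *)
by rewrite nth_default ?size_map.
Qed.

End LocalBound.

(** * The signed triangulation and its coordinates *)

Definition pos_edges : seq (nat * nat) :=
  [:: (0, 1); (0, 6); (0, 7); (0, 8); (0, 20); (0, 22); (0, 34); (1, 2);
      (1, 3); (1, 5); (1, 12); (1, 18); (1, 19); (1, 21); (1, 30); (2, 3);
      (2, 4); (2, 8); (2, 11); (2, 24); (2, 41); (3, 6); (3, 14); (3, 15);
      (4, 6); (4, 7); (4, 40); (4, 42); (4, 54); (5, 6); (6, 16); (6, 17);
      (7, 10); (7, 11); (7, 16); (7, 38); (7, 39); (7, 41); (7, 50); (8, 9);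
      (8, 11); (9, 10); (10, 11); (12, 13); (12, 15); (13, 14); (14, 15);
      (19, 21); (20, 22); (20, 23); (20, 24); (21, 23); (21, 24); (21, 27);
      (21, 32); (21, 33); (22, 26); (22, 36); (22, 37); (23, 25); (23, 26);
      (24, 25); (24, 29); (30, 31); (30, 33); (31, 32); (32, 33); (34, 35);
      (34, 37); (35, 36); (36, 37); (39, 41); (40, 42); (40, 43); (40, 44);
      (41, 43); (41, 44); (41, 47); (41, 49); (41, 52); (41, 53); (42, 46);
      (42, 56); (42, 57); (43, 45); (43, 46); (44, 45); (50, 51); (50, 53);
      (51, 52); (52, 53); (54, 55); (54, 57); (55, 56); (56, 57)]%N.

Definition neg_edges : seq (nat * nat) :=
  [:: (0, 2); (0, 10); (0, 16); (0, 18); (0, 24); (0, 36); (1, 6); (1, 14);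
      (1, 32); (2, 7); (2, 12); (2, 15); (2, 21); (2, 29); (2, 44); (2, 49);
      (3, 4); (3, 5); (3, 17); (4, 17); (4, 38); (4, 44); (4, 56); (6, 7);
      (7, 52); (8, 10); (9, 11); (12, 14); (13, 15); (18, 19); (18, 22);
      (18, 28); (19, 22); (19, 23); (19, 27); (19, 28); (19, 30); (19, 33);
      (20, 25); (20, 26); (20, 34); (20, 37); (21, 29); (22, 23); (22, 28);
      (23, 24); (23, 27); (30, 32); (31, 33); (34, 36); (35, 37); (38, 39);
      (38, 42); (38, 48); (39, 42); (39, 43); (39, 47); (39, 48); (39, 50);
      (39, 53); (40, 45); (40, 46); (40, 54); (40, 57); (42, 43); (42, 48);
      (43, 44); (43, 47); (44, 49); (50, 52); (51, 53); (54, 56); (55, 57)]%N.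

Delimit Scope Z_scope with binZ.

(* A weighted Tutte embedding with outer face [0, 1, 6], rounded to integers. *)
Definition coordinates : seq (Z * Z) :=
  [:: (0, 0); (500, 0); (212, 109); (230, 228); (117, 288); (247, 249);
      (0, 500); (71, 219); (97, 74); (92, 105); (59, 103); (115, 130);
      (352, 72); (326, 106); (356, 106); (286, 132); (13, 253); (107, 357);
      (250, 2); (320, 9); (121, 12); (314, 32); (165, 6); (223, 18);
      (169, 34); (171, 18); (173, 14); (277, 19); (242, 7); (238, 57);
      (407, 7); (387, 13); (404, 14); (362, 16); (68, 5); (90, 5); (82, 4);
      (111, 6); (103, 244); (113, 215); (133, 239); (143, 179); (120, 245);
      (134, 214); (158, 195); (144, 216); (129, 231); (130, 200); (113, 233);
      (176, 154); (98, 210); (108, 203); (107, 200); (119, 198); (124, 263);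
      (123, 260); (120, 265); (125, 253)]%binZ.

(* A tetrahedron is listed with its base first, a filled positive triangle (a
   "cap") with the triangle first.  The events are those in which the bounds
   for these pieces improve from 2 to 1: [s] misses the base, respectively
   contains the triangle. *)
Definition events (s : pred nat) (tetras caps : seq (seq nat)) : nat :=
  count (fun m => ~~ has s (take 3 m)) tetras + count (fun m => all s (take 3 m)) caps.

Lemma events_cat s t1 t2 c1 c2 :
  events s (t1 ++ t2) (c1 ++ c2) = (events s t1 c1 + events s t2 c2)%N.
Proof. by rewrite /events !count_cat addnACA. Qed.

(** * Templates of the pieces and their local bounds *)

Definition tetra_cycles : seq (seq nat) :=
  [:: [:: 0; 1; 2]; [:: 0; 1; 3]; [:: 0; 2; 3]; [:: 1; 2; 3]]%N.

Definition tetra_bound (b : bitseq) : bool :=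
  (count id b + ~~ has id (take 3 b) <= 2)%N.

(** The last four cycles make [3, 4, 5, 6] an all-negative tetrahedron, so at most two are selected.
    Once [0, 1, 2] are selected, the first three exclude [3, 5, 6]. *)
Definition cap_cycles : seq (seq nat) :=
  [:: [:: 0; 1; 3]; [:: 0; 2; 5]; [:: 1; 2; 6]; [:: 3; 4; 5]; [:: 3; 4; 6];
      [:: 3; 5; 6]; [:: 4; 5; 6]]%N.

Definition cap_bound (b : bitseq) : bool :=
  (count id (drop 3 b) + all id (take 3 b) <= 2)%N.

(** Suppose [0] and [1] are selected and no event occurs. Then [2] and [3] are out, so exactly one
    of [4, 7] and one of [6, 9] is in. Selecting [4] forces [9] and [8], closing [0 1 4 8 9];
    selecting [7] excludes [5] and forces [8], closing [0 1 6 8 7] or [0 7 8 9]. *)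
Definition digon_cycles : seq (seq nat) :=
  [:: [:: 0; 1; 2]; [:: 0; 1; 3]; [:: 0; 5; 9]; [:: 0; 1; 4; 7]; [:: 0; 1; 6; 9];
      [:: 0; 7; 8; 9]; [:: 0; 1; 4; 8; 9]; [:: 0; 1; 6; 8; 7]]%N.

(* The outer triangle is [0, 1, 2], with distinguished vertices 0 and 1. *)
Definition digon_bound (b : bitseq) : bool :=
  (nth false b 0 && nth false b 1 <=
     events (nth false b)
       [:: [:: 5; 8; 9]; [:: 5; 7; 8]; [:: 4; 6; 8]; [:: 3; 4; 7]; [:: 2; 6; 9]]
       [:: [:: 1; 4; 6]; [:: 0; 5; 7]])%N.

Definition core_cycles : seq (seq nat) :=
  [:: [:: 0; 1; 2]; [:: 1; 3; 5]; [:: 1; 3; 6]; [:: 1; 5; 6]; [:: 2; 3; 4];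
      [:: 2; 4; 7]; [:: 3; 5; 6]; [:: 0; 2; 4; 6]; [:: 1; 2; 4; 6]; [:: 1; 2; 7; 6]]%N.

(* Vertex 1 of the core is listed twice: it has weight 2. *)
Definition core_weights : seq nat := [:: 0; 1; 1; 2; 3; 4; 5; 6; 7]%N.

Definition core_bound (b : bitseq) : bool :=
  (count (nth false b) core_weights <=
     4 + (nth false b 0 && nth false b 1) + (nth false b 4 && nth false b 7)
       + events (nth false b) [:: [:: 0; 6; 7]; [:: 3; 4; 6]] [:: [:: 0; 2; 7]; [:: 1; 2; 3]])%N.

(* From here on vertices are those of the 58-vertex graph; the core consists of
   [0 .. 7], and every piece lists the images of the vertices of its template. *)
Definition core_tetras : seq (seq nat) := [:: [:: 0; 6; 7; 16]; [:: 3; 4; 6; 17]]%N.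

Definition core_caps : seq (seq nat) :=
  [:: [:: 0; 2; 7; 8; 9; 10; 11]; [:: 1; 2; 3; 12; 13; 14; 15]]%N.

Definition digon01 : seq nat := [:: 0; 1; 2; 18; 19; 20; 21; 22; 23; 24]%N.

Definition digon01_tetras : seq (seq nat) :=
  [:: [:: 20; 23; 24; 25]; [:: 20; 22; 23; 26]; [:: 19; 21; 23; 27];
      [:: 18; 19; 22; 28]; [:: 2; 21; 24; 29]]%N.

Definition digon01_caps : seq (seq nat) :=
  [:: [:: 1; 19; 21; 30; 31; 32; 33]; [:: 0; 20; 22; 34; 35; 36; 37]]%N.

Definition digon47 : seq nat := [:: 4; 7; 2; 38; 39; 40; 41; 42; 43; 44]%N.

Definition digon47_tetras : seq (seq nat) :=
  [:: [:: 40; 43; 44; 45]; [:: 40; 42; 43; 46]; [:: 39; 41; 43; 47];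
      [:: 38; 39; 42; 48]; [:: 2; 41; 44; 49]]%N.

Definition digon47_caps : seq (seq nat) :=
  [:: [:: 7; 39; 41; 50; 51; 52; 53]; [:: 4; 40; 42; 54; 55; 56; 57]]%N.

Definition tetras := core_tetras ++ digon01_tetras ++ digon47_tetras.

Definition caps := core_caps ++ digon01_caps ++ digon47_caps.

(** Tetrahedra count with their bases, caps only with their four inner vertices: the total is
    [9 + 12 * 4 + 6 * 4 = 81]. *)
Definition weights : seq nat :=
  core_weights ++ flatten tetras ++ flatten (map (drop 3) caps).

Lemma edges_loopless : all (fun e => e.1 != e.2) (pos_edges ++ neg_edges).
Proof. by vm_compute. Qed.

Definition witness : signed_sgraph := list_signed 58 edges_loopless.

Lemma witness_planar (R : realType) : planar R witness.
Proof. by apply: (@list_planar _ _ _ coordinates edges_loopless R); vm_compute. Qed.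

Definition carries (cycles : seq (seq nat)) (m : seq nat) : bool :=
  all (fun c => neg_cycle_list 58 pos_edges neg_edges (map (nth 0%N m) c)) cycles.

Lemma tetras_carry : all (carries tetra_cycles) tetras.
Proof. by vm_compute. Qed.

Lemma caps_carry : all (carries cap_cycles) caps.
Proof. by vm_compute. Qed.

(** * Adding up the local bounds *)

Section WitnessWeight.
Variable S : {set witness}.
Hypothesis bS : balanced S.

Let s (k : nat) : bool := inord k \in S.

Let tetra_count m : m \in tetras -> (count s m + ~~ has s (take 3 m) <= 2)%N.
Proof.
move=> mt; have /allP/(_ _ mt)/eqP sz : all (fun m => size m == 4%N) tetras by [].
have : tetra_bound (map s m).
  apply: (local_bound bS (C := tetra_cycles)); first exact: (allP tetras_carry).
  by rewrite sz; vm_compute.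
by rewrite /tetra_bound count_map -map_take has_map.
Qed.

Let cap_count m : m \in caps -> (count s (drop 3 m) + all s (take 3 m) <= 2)%N.
Proof.
move=> mt; have /allP/(_ _ mt)/eqP sz : all (fun m => size m == 7%N) caps by [].
have : cap_bound (map s m).
  apply: (local_bound bS (C := cap_cycles)); first exact: (allP caps_carry).
  by rewrite sz; vm_compute.
by rewrite /cap_bound -map_drop count_map -map_take all_map.
Qed.

Let digon01_count : (s 0 && s 1 <= events s digon01_tetras digon01_caps)%N.
Proof.
by apply: (local_bound bS (m := digon01) (C := digon_cycles) (Q := digon_bound)); vm_compute.
Qed.

Let digon47_count : (s 4 && s 7 <= events s digon47_tetras digon47_caps)%N.
Proof.
by apply: (local_bound bS (m := digon47) (C := digon_cycles) (Q := digon_bound)); vm_compute.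
Qed.

Let core_count :
  (count s core_weights <= 4 + (s 0 && s 1) + (s 4 && s 7) + events s core_tetras core_caps)%N.
Proof.
by apply: (local_bound bS (m := iota 0 8) (C := core_cycles) (Q := core_bound)); vm_compute.
Qed.

Let piecewise_count (u : seq nat -> seq nat) (v : pred (seq nat)) (ms : seq (seq nat)) :
    (forall m, m \in ms -> count s (u m) + v m <= 2)%N ->
  (count s (flatten (map u ms)) + count v ms <= 2 * size ms)%N.
Proof.
elim: ms => //= m ms IH le2; rewrite count_cat addnACA mulnS leq_add ?le2 ?mem_head //.
by apply: IH => m' m'ms; apply: le2; rewrite inE m'ms orbT.
Qed.

Lemma witness_weight : (count [in S] (map (@inord 57) weights) <= 40)%N.
Proof.
have -> : count [in S] (map (@inord 57) weights) =
    (count s core_weights + (count s (flatten tetras) + count s (flatten (map (drop 3) caps))))%N.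
  by rewrite count_map 2!count_cat.
have le_tetras : (count s (flatten tetras) + count (fun m => ~~ has s (take 3 m)) tetras <= 24)%N.
  by have := piecewise_count (u := id) tetra_count; rewrite map_id.
have le_caps : (count s (flatten (map (drop 3) caps)) + count (fun m => all s (take 3 m)) caps <= 12)%N.
  exact: piecewise_count cap_count.
(* The events gained by the core are exactly those lost by the tetrahedra and caps, so they cancel
   and [4 + 24 + 12 = 40] remains. *)
have : (count s core_weights <= 4 + events s tetras caps)%N.
  apply: leq_trans core_count _; rewrite !events_cat.
  by move: digon01_count digon47_count; lia.
by rewrite /events; lia.
Qed.

End WitnessWeight.

Lemma witness_chi_fb (R : realType) : 81 / 40 <= chi_fb R witness.
Proof. exact: (chi_fb_ge R _ witness_weight). Qed.

Theorem theorem2 (R : realType) :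
  ((2 + 1 / 41 : R)%:E <=
     ereal_sup [set x | exists G : signed_sgraph, planar R G /\ x = (chi_fb R G)%:E])%E
  /\ 2 + 1 / 41 = 83 / 41 :> R.
Proof.
split; last by field.
apply: (@le_trans _ _ (chi_fb R witness)%:E); last first.
  by apply: ereal_sup_ubound; exists witness; split => //; exact: witness_planar.
(* Cross-multiplied, [83 * 40 = 3320] against [81 * 41 = 3321]. *)
by rewrite lee_fin; apply: le_trans (witness_chi_fb R); lra.
Qed.
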